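(* Let $a\in\mathbb C$ and $j\in\mathbb Z$. The graded subspaces of $\mathcal{SD}^{\sigma_{-+,a}}$ of degrees $j$ and $j-\frac12$ are $$\mathcal{SD}^{\sigma_{-+,a}}_j=\{\partial_\theta\theta\, t^jf(D)-(-1)^j\theta\partial_\theta\, t^jf(-D-j+a)\mid f\in\mathbb C[w]\},$$ $$\mathcal{SD}^{\sigma_{-+,a}}_{j-1/2}=\{\theta\, t^{j-1}f(D+(j-a-1)/2)+\partial_\theta\, t^jg(D+(j-a)/2)\mid f,g\in\mathbb C^{(\overline{j+1})}[w]\}.$$
   Context: $\mathcal{SD}$ is the Lie superalgebra (supercommutator bracket) of the associative superalgebra over $\mathbb C$ generated by even $t^{\pm1}$, $D=t\frac{d}{dt}$ and odd $\theta,\partial_\theta$, with $f(D)t=tf(D+1)$, $\theta^2=\partial_\theta^2=0$, $\theta\partial_\theta+\partial_\theta\theta=1$, $\theta,\partial_\theta$ commuting with $t,D$. It has basis $t^kD^l$ ($k\in\mathbb Z,l\ge0$) times $\theta\partial_\theta,\partial_\theta\theta,\theta,\partial_\theta$. It is $\frac12\mathbb Z$-graded (principal gradation) by $wt(t)=1$, $wt(D)=0$, $wt(\theta)=\frac12$, $wt(\partial_\theta)=-\frac12$. The anti-involution $\sigma_{-+,a}$ is the $\mathbb C$-linear map with $\sigma(XY)=(-1)^{|X||Y|}\sigma(Y)\sigma(X)$ determined by $t\mapsto -t$, $D\mapsto-D+a$, $\theta\mapsto\theta$, $\partial_\theta\mapsto-\partial_\theta$. For an anti-involution $\sigma$ put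 $\mathcal{SD}^\sigma=\{e\in\mathcal{SD}\mid\sigma(e)=-e\}$, graded by the principal gradation. $\mathbb C^{(0)}[w]$ (resp. $\mathbb C^{(1)}[w]$) is the space of even (resp. odd) polynomials in $w$; $\overline k=0$ if $k$ is odd and $\overline k=1$ if $k$ is even. *)

(* Defs.v *)
From HB Require Import structures.
From mathcomp Require Import all_boot all_order all_algebra finmap.
From mathcomp Require Import boolp classical_sets reals.
From mathcomp.multinomials Require Import monalg.
From mathcomp.real_closed Require Import complex.

Set Implicit Arguments.
Unset Strict Implicit.
Unset Printing Implicit Defensive.

Import GRing.Theory.
Local Open Scope ring_scope.

(* Differential operators on the circle: an element is a finite sum
   \sum_k t^k f_k(D), stored as the finitely supported map k |-> f_k. *)
Definition diffop (F : fieldType) := {malg {poly F}[int]}.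

HB.instance Definition _ (F : fieldType) :=
  GRing.Zmodule.copy (diffop F) {malg {poly F}[int]}.

Section DiffOp.
Variable F : fieldType.
Implicit Types (x y z : diffop F) (f g : {poly F}) (k m : int) (c : F).

(* f(D) t^m = t^m f(D + m) *)
Definition pshift m f : {poly F} := f \Po ('X + (m%:~R)%:P).

Definition tD k f : diffop F := << f *g k >>.

Definition dmul x y : diffop F :=
  \sum_(k <- msupp x) \sum_(m <- msupp y) tD (k + m) (pshift m x@_k * y@_m).

Definition diffop1 : diffop F := tD 0 1.

Definition dscale c x : diffop F := (c%:P *: (x : {malg {poly F}[int]})).

Lemma pshift0 f : pshift 0 f = f.
Proof. by rewrite /pshift addr0 comp_polyXr. Qed.

Lemma pshift_pshift m n f : pshift n (pshift m f) = pshift (m + n) f.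
Proof.
rewrite /pshift -comp_polyA comp_polyD comp_polyX comp_polyC -addrA -polyCD.
by rewrite -rmorphD /= [n + m]addrC.
Qed.

Lemma pshiftM m f g : pshift m (f * g) = pshift m f * pshift m g.
Proof. exact: comp_polyM. Qed.

Lemma pshiftD m f g : pshift m (f + g) = pshift m f + pshift m g.
Proof. exact: comp_polyD. Qed.

Lemma pshiftZ m c f : pshift m (c *: f) = c *: pshift m f.
Proof. exact: comp_polyZ. Qed.

Lemma pshift00 m : pshift m 0 = 0.
Proof. exact: comp_poly0. Qed.

Lemma pshift1 m : pshift m 1 = 1.
Proof. by rewrite /pshift -polyC1 comp_polyC. Qed.

Lemma tDD k f g : tD k (f + g) = tD k f + tD k g.
Proof. exact: monalgUD. Qed.

Lemma tD0 k : tD k 0 = 0.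
Proof. exact: monalgU0. Qed.

Lemma tDN k f : tD k (- f) = - tD k f.
Proof. exact: monalgUN. Qed.

Lemma diffopE x : x = \sum_(k <- msupp x) tD k x@_k.
Proof. exact: monalgE. Qed.

Lemma diffop_ind (P : diffop F -> Prop) :
  P 0 -> (forall k f x, P x -> P (tD k f + x)) -> forall x, P x.
Proof.
move=> P0 PD x; rewrite [x]diffopE.
by elim: (enum_fset _) => [|k s IH]; rewrite ?big_nil // big_cons; apply: PD.
Qed.

Lemma dmulw (d1 d2 : {fset int}) x y :
  (msupp x `<=` d1)%fset -> (msupp y `<=` d2)%fset ->
  dmul x y = \sum_(k <- d1) \sum_(m <- d2) tD (k + m) (pshift m x@_k * y@_m).
Proof.
move=> le1 le2; rewrite /dmul (big_fset_incl _ le1) /=.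
  apply/eq_bigr => k _; apply: big_fset_incl => // m _ /mcoeff_outdom ->.
  by rewrite mulr0 tD0.
by move=> k _ /mcoeff_outdom ->; rewrite big1 // => m _; rewrite pshift00 mul0r tD0.
Qed.

Lemma dmulUU k m f g :
  dmul (tD k f) (tD m g) = tD (k + m) (pshift m f * g).
Proof.
by rewrite (dmulw msuppU_le msuppU_le) !big_seq_fset1 /tD !mcoeffUU.
Qed.

Lemma dmulDl : left_distributive dmul +%R.
Proof.
move=> x y z.
rewrite (dmulw (msuppD_le x y) (fsubset_refl _)).
rewrite (dmulw (fsubsetUl _ (msupp y)) (fsubset_refl (msupp z))).
rewrite (dmulw (fsubsetUr (msupp x) _) (fsubset_refl (msupp z))).
rewrite -big_split /=; apply/eq_bigr => k _.
rewrite -big_split /=; apply/eq_bigr => m _.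
by rewrite mcoeffD pshiftD mulrDl tDD.
Qed.

Lemma dmulDr : right_distributive dmul +%R.
Proof.
move=> z x y.
rewrite (dmulw (fsubset_refl _) (msuppD_le x y)).
rewrite (dmulw (fsubset_refl (msupp z)) (fsubsetUl _ (msupp y))).
rewrite (dmulw (fsubset_refl (msupp z)) (fsubsetUr (msupp x) _)).
rewrite -big_split /=; apply/eq_bigr => k _.
rewrite -big_split /=; apply/eq_bigr => m _.
by rewrite mcoeffD mulrDr tDD.
Qed.

Lemma dmul0x : left_zero 0 dmul.
Proof. by move=> x; rewrite /dmul msupp0 big_seq_fset0. Qed.

Lemma dmulx0 : right_zero 0 dmul.
Proof.
by move=> x; rewrite /dmul msupp0 big1 // => k _; rewrite big_seq_fset0.
Qed.

Lemma dmulA : associative dmul.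
Proof.
move=> x y z; elim/diffop_ind: x => [|k f x IHx]; first by rewrite !dmul0x.
rewrite !dmulDl IHx; congr (_ + _); clear x IHx.
elim/diffop_ind: y => [|m g y IHy]; first by rewrite !(dmul0x, dmulx0).
rewrite !(dmulDl, dmulDr) IHy; congr (_ + _); clear y IHy.
elim/diffop_ind: z => [|n h z IHz]; first by rewrite !dmulx0.
rewrite !dmulDr IHz !dmulUU; congr (_ + _).
by rewrite pshiftM pshift_pshift mulrA addrA.
Qed.

Lemma dmul1x : left_id diffop1 dmul.
Proof.
move=> x; elim/diffop_ind: x => [|k f x IH]; first by rewrite dmulx0.
by rewrite dmulDr IH dmulUU add0r pshift1 mul1r.
Qed.

Lemma dmulx1 : right_id diffop1 dmul.
Proof.
move=> x; elim/diffop_ind: x => [|k f x IH]; first by rewrite dmul0x.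
by rewrite dmulDl IH dmulUU addr0 pshift0 mulr1.
Qed.

Lemma diffop1_neq0 : diffop1 != 0.
Proof.
apply/eqP => /malgP/(_ 0) /eqP.
by rewrite /diffop1 /tD mcoeffUU mcoeff0 oner_eq0.
Qed.

HB.instance Definition _ := GRing.Zmodule_isNzRing.Build (diffop F)
  dmulA dmul1x dmulx1 dmulDl dmulDr diffop1_neq0.

Lemma tDM k m f g : tD k f * tD m g = tD (k + m) (pshift m f * g).
Proof. exact: dmulUU. Qed.

Lemma dscaleA c1 c2 x : dscale c1 (dscale c2 x) = dscale (c1 * c2) x.
Proof. by rewrite /dscale scalerA polyCM. Qed.

Lemma dscale1 : left_id 1 dscale.
Proof. by move=> x; rewrite /dscale scale1r. Qed.

Lemma dscaleDr : right_distributive dscale +%R.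
Proof. by move=> c x y; rewrite /dscale scalerDr. Qed.

Lemma dscaleDl x : {morph dscale^~ x : c1 c2 / c1 + c2}.
Proof. by move=> c1 c2; rewrite /dscale polyCD scalerDl. Qed.

HB.instance Definition _ := GRing.Zmodule_isLmodule.Build F (diffop F)
  dscaleA dscale1 dscaleDr dscaleDl.

Lemma scale_tD c k f : c *: tD k f = tD k (c *: f).
Proof.
apply/malgP => m; rewrite /GRing.scale /= /dscale /tD mcoeffZ !mcoeffU.
by rewrite mulrnAr mul_polyC.
Qed.

Lemma dscaleAl c x y : c *: (x * y) = (c *: x) * y.
Proof.
elim/diffop_ind: x => [|k f x IHx]; first by rewrite !(scaler0, mul0r).
rewrite !(mulrDl, scalerDr) IHx; congr (_ + _); clear x IHx.
elim/diffop_ind: y => [|m g y IHy]; first by rewrite !(scaler0, mulr0).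
by rewrite !(mulrDr, scalerDr) IHy scale_tD !tDM scale_tD pshiftZ scalerAl.
Qed.

HB.instance Definition _ :=
  GRing.Lmodule_isLalgebra.Build F (diffop F) dscaleAl.

Lemma dscaleAr c x y : c *: (x * y) = x * (c *: y).
Proof.
elim/diffop_ind: x => [|k f x IHx]; first by rewrite !(scaler0, mul0r).
rewrite !(mulrDl, scalerDr) IHx; congr (_ + _); clear x IHx.
elim/diffop_ind: y => [|m g y IHy]; first by rewrite !(scaler0, mulr0).
by rewrite !(mulrDr, scalerDr) IHy !(scale_tD, tDM) scalerAr.
Qed.

HB.instance Definition _ :=
  GRing.Lalgebra_isAlgebra.Build F (diffop F) dscaleAr.

End DiffOp.

(* SD is diffop tensored with the 4-dimensional Clifford algebra generated by
   theta and d_theta, i.e. 2 x 2 matrices over diffop, with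
   theta d_theta = E_00, d_theta theta = E_11, theta = E_01, d_theta = E_10. *)
Definition SD (F : fieldType) := 'M[diffop F]_2.

HB.instance Definition _ (F : fieldType) :=
  GRing.Zmodule.copy (SD F) 'M[diffop F]_2.

HB.lock Definition sdmul (F : fieldType) (x y : SD F) : SD F := x *m y.

Definition sdone (F : fieldType) : SD F := 1%:M.

Section SDRing.
Variable F : fieldType.

Lemma sdmulA : associative (@sdmul F).
Proof. by move=> x y z; rewrite sdmul.unlock mulmxA. Qed.

Lemma sdmul1 : left_id (sdone F) (@sdmul F).
Proof. by move=> x; rewrite sdmul.unlock mul1mx. Qed.

Lemma sdmulr1 : right_id (sdone F) (@sdmul F).
Proof. by move=> x; rewrite sdmul.unlock mulmx1. Qed.

Lemma sdmulDl : left_distributive (@sdmul F) +%R.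
Proof. by move=> x y z; rewrite sdmul.unlock; apply: mulmxDl. Qed.

Lemma sdmulDr : right_distributive (@sdmul F) +%R.
Proof. by move=> x y z; rewrite sdmul.unlock; apply: mulmxDr. Qed.

Lemma sdone_neq0 : sdone F != 0.
Proof. exact: (oner_neq0 'M[diffop F]_2). Qed.

HB.instance Definition _ := GRing.Zmodule_isNzRing.Build (SD F)
  sdmulA sdmul1 sdmulr1 sdmulDl sdmulDr sdone_neq0.

Lemma sd_mulE (x y : SD F) i j : (x * y) i j = x i 0 * y 0 j + x i 1 * y 1 j.
Proof.
rewrite /GRing.mul /= sdmul.unlock mxE !big_ord_recl big_ord0 addr0.
by rewrite (_ : lift _ _ = 1) //; apply/val_inj.
Qed.

End SDRing.

Section SD.
Variable F : fieldType.
Implicit Types (x y : SD F) (f : {poly F}) (c : F).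

Definition sdscale c x : SD F := map_mx (fun u : diffop F => c *: u) x.

Lemma sdscaleA c1 c2 x : sdscale c1 (sdscale c2 x) = sdscale (c1 * c2) x.
Proof. by apply/matrixP => i j; rewrite !mxE scalerA. Qed.

Lemma sdscale1 : left_id 1 sdscale.
Proof. by move=> x; apply/matrixP => i j; rewrite !mxE scale1r. Qed.

Lemma sdscaleDr : right_distributive sdscale +%R.
Proof. by move=> c x y; apply/matrixP => i j; rewrite !mxE scalerDr. Qed.

Lemma sdscaleDl x : {morph sdscale^~ x : c1 c2 / c1 + c2}.
Proof. by move=> c1 c2; apply/matrixP => i j; rewrite !mxE scalerDl. Qed.

HB.instance Definition _ := GRing.Zmodule_isLmodule.Build F (SD F)
  sdscaleA sdscale1 sdscaleDr sdscaleDl.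

Lemma sdscaleAl c x y : c *: (x * y) = (c *: x) * y.
Proof.
apply/matrixP => i j; rewrite !(sd_mulE, mxE) scalerDr.
by rewrite !scalerAl.
Qed.

HB.instance Definition _ := GRing.Lmodule_isLalgebra.Build F (SD F) sdscaleAl.

Lemma sdscaleAr c x y : c *: (x * y) = x * (c *: y).
Proof.
apply/matrixP => i j; rewrite !(sd_mulE, mxE) scalerDr.
by rewrite !scalerAr.
Qed.

HB.instance Definition _ := GRing.Lalgebra_isAlgebra.Build F (SD F) sdscaleAr.

Lemma ord2P (i : 'I_2) : i = 0 \/ i = 1.
Proof. by case: i => [[|[|//]]] p; [left | right]; apply/val_inj. Qed.

Lemma sdP x y : x 0 0 = y 0 0 -> x 0 1 = y 0 1 -> x 1 0 = y 1 0 ->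
  x 1 1 = y 1 1 -> x = y.
Proof.
move=> h00 h01 h10 h11.
by apply/matrixP => i j; case: (ord2P i) => ->; case: (ord2P j) => ->.
Qed.

Lemma sd_scaleE c x i j : (c *: x) i j = c *: (x i j).
Proof. by rewrite mxE. Qed.

Lemma sd_addE x y i j : (x + y) i j = x i j + y i j.
Proof. by rewrite mxE. Qed.

Lemma sd_oppE x i j : (- x) i j = - x i j.
Proof. by rewrite mxE. Qed.

Lemma sd_0E i j : (0 : SD F) i j = 0.
Proof. by rewrite mxE. Qed.

Definition dmx (u : diffop F) : SD F := u%:M.

Lemma dmxE u i j : dmx u i j = u *+ (i == j).
Proof. by rewrite mxE. Qed.

Definition tpow (k : int) : SD F := dmx (tD k 1).
Definition SDD : SD F := dmx (tD 0 'X).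
Definition theta : SD F := delta_mx 0 1.
Definition dtheta : SD F := delta_mx 1 0.

Lemma thetaE i j : theta i j = ((i == 0) && (j == 1))%:R.
Proof. by rewrite mxE. Qed.
Lemma dthetaE i j : dtheta i j = ((i == 1) && (j == 0))%:R.
Proof. by rewrite mxE. Qed.

End SD.

Ltac sd_ext := apply: sdP;
  rewrite !(sd_0E, sd_mulE, sd_addE, sd_oppE, sd_scaleE, dmxE, thetaE, dthetaE) /=
    ?(mulr1n, mulr0n, mulr1, mul1r, mulr0, mul0r, addr0, add0r, oppr0, scaler0).

Section Presentation.
Variable F : fieldType.
Implicit Types (x y : SD F) (f : {poly F}) (c : F) (u v : diffop F).

Local Notation tpow := (tpow F).
Local Notation SDD := (SDD F).
Local Notation theta := (theta F).
Local Notation dtheta := (dtheta F).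

Lemma dmxM u v : dmx (u * v) = dmx u * dmx v :> SD F.
Proof. by sd_ext. Qed.

Lemma dmxD u v : dmx (u + v) = dmx u + dmx v :> SD F.
Proof. by sd_ext. Qed.

Lemma dmxZ c u : dmx (c *: u) = c *: dmx u :> SD F.
Proof. by sd_ext. Qed.

Lemma dmx1 : dmx 1 = 1 :> SD F. Proof. by []. Qed.

Lemma dmx0 : dmx 0 = 0 :> SD F.
Proof. by apply: sdP; rewrite dmxE mul0rn sd_0E. Qed.

Lemma tD0C c : tD 0 c%:P = c%:A :> diffop F.
Proof. by rewrite scale_tD alg_polyC. Qed.

Lemma horner_dmx (p f : {poly F}) :
  horner_alg (dmx (tD 0 p)) f = dmx (tD 0 (f \Po p)).
Proof.
elim/poly_ind: f => [|f c IH].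
  by rewrite comp_poly0 tD0 rmorph0 dmx0.
rewrite rmorphD rmorphM /= IH horner_algX horner_algC.
rewrite comp_polyD comp_polyM comp_polyX comp_polyC tDD dmxD; congr (_ + _).
  by rewrite -dmxM tDM pshift0 addr0.
by rewrite tD0C dmxZ dmx1.
Qed.

Lemma horner_SDD f : horner_alg SDD f = dmx (tD 0 f).
Proof. by rewrite /SDD horner_dmx comp_polyXr. Qed.

Lemma horner_SDDc c f :
  horner_alg (SDD + c%:A) f = dmx (tD 0 (f \Po ('X + c%:P))).
Proof.
rewrite -horner_dmx; congr (horner_alg _ f).
by rewrite tDD dmxD tD0C dmxZ dmx1.
Qed.

Lemma tpow_horner k f : tpow k * horner_alg SDD f = dmx (tD k f).
Proof.
by rewrite horner_SDD /tpow -dmxM tDM pshift0 mul1r addr0.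
Qed.

Lemma tpow0 : tpow 0 = 1. Proof. by []. Qed.

Lemma tpowD k m : tpow (k + m) = tpow k * tpow m.
Proof. by rewrite /tpow -dmxM tDM pshift1 mulr1. Qed.

Lemma horner_tpow f :
  horner_alg SDD f * tpow 1 = tpow 1 * horner_alg (SDD + 1) f.
Proof.
rewrite -[in RHS](scale1r 1) horner_SDDc horner_SDD /tpow -!dmxM !tDM.
by rewrite add0r addr0 mulr1 pshift0 mul1r /pshift.
Qed.

Lemma theta2 : theta * theta = 0. Proof. by sd_ext. Qed.
Lemma dtheta2 : dtheta * dtheta = 0. Proof. by sd_ext. Qed.
Lemma theta_dtheta : theta * dtheta + dtheta * theta = 1.
Proof. by rewrite -dmx1; sd_ext. Qed.

Lemma theta_dmx u : theta * dmx u = dmx u * theta. Proof. by sd_ext. Qed.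
Lemma dtheta_dmx u : dtheta * dmx u = dmx u * dtheta. Proof. by sd_ext. Qed.

Lemma theta_tpow k : theta * tpow k = tpow k * theta.
Proof. exact: theta_dmx. Qed.
Lemma dtheta_tpow k : dtheta * tpow k = tpow k * dtheta.
Proof. exact: dtheta_dmx. Qed.
Lemma theta_SDD : theta * SDD = SDD * theta.
Proof. exact: theta_dmx. Qed.
Lemma dtheta_SDD : dtheta * SDD = SDD * dtheta.
Proof. exact: dtheta_dmx. Qed.

End Presentation.

Variant sdunit := ThDth | DthTh | Th | Dth.

Definition sdunit_elt (F : fieldType) (u : sdunit) : SD F :=
  match u with
  | ThDth => theta F * dtheta F
  | DthTh => dtheta F * theta F
  | Th => theta F
  | Dth => dtheta F
  end.

Definition sdunit_odd (u : sdunit) : bool :=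
  match u with ThDth | DthTh => false | Th | Dth => true end.

Definition sdunit_wt (u : sdunit) : rat :=
  match u with ThDth | DthTh => 0 | Th => 2%:R^-1 | Dth => - 2%:R^-1 end.

(* Monomials t^k D^l u; wt(t) = 1, wt(D) = 0. *)
Definition sdmon (F : fieldType) (k : int) (l : nat) (u : sdunit) : SD F :=
  tpow F k * SDD F ^+ l * sdunit_elt F u.

Definition sdmon_wt (k : int) (u : sdunit) : rat := k%:~R + sdunit_wt u.

Definition lin_span (F : fieldType) (V : lmodType F) (S : set V) : set V :=
  [set x | exists2 s : seq (F * V), (forall p, p \in s -> S p.2) &
     x = \sum_(p <- s) p.1 *: p.2]%classic.

Section LinSpan.
Variables (F : fieldType) (V : lmodType F) (S : set V).

Lemma lin_span_ind (P : V -> Prop) :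
    P 0 -> (forall c x y, S x -> P y -> P (c *: x + y)) ->
  forall x, lin_span S x -> P x.
Proof.
move=> P0 PD x [s Ss ->]; elim: s Ss => [|[c y] s IH] Ss; first by rewrite big_nil.
rewrite big_cons; apply: PD => /=; first exact: (Ss _ (mem_head _ _)).
by apply: IH => p ps; apply: Ss; rewrite in_cons ps orbT.
Qed.

Lemma lin_span0 : lin_span S 0.
Proof. by exists [::]; rewrite ?big_nil. Qed.

Lemma lin_spanD x y : lin_span S x -> lin_span S y -> lin_span S (x + y).
Proof.
move=> [s Ss ->] [s' Ss' ->]; exists (s ++ s'); last by rewrite big_cat.
by move=> p; rewrite mem_cat => /orP[/Ss|/Ss'].
Qed.

Lemma lin_spanZ c x : S x -> lin_span S (c *: x).
Proof.
by move=> Sx; exists [:: (c, x)]; rewrite ?big_seq1 // => p; rewrite inE => /eqP->.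
Qed.

Lemma lin_span_sum I (r : seq I) (G : I -> V) :
  (forall i, lin_span S (G i)) -> lin_span S (\sum_(i <- r) G i).
Proof.
by move=> SG; elim/big_rec: _ => [|i x _ Sx]; [exact: lin_span0|exact: lin_spanD].
Qed.

End LinSpan.

Definition SDparity (F : fieldType) (p : bool) : set (SD F) :=
  lin_span [set x | exists k l u, sdunit_odd u = p /\ x = sdmon F k l u]%classic.

Definition SDdeg (F : fieldType) (q : rat) : set (SD F) :=
  lin_span [set x | exists k l u, sdmon_wt k u = q /\ x = sdmon F k l u]%classic.

Section Basis.
Variable F : fieldType.
Implicit Types (x y : SD F).

Definition sdrow (u : sdunit) : 'I_2 :=
  match u with ThDth | Th => 0 | DthTh | Dth => 1 end.
Definition sdcol (u : sdunit) : 'I_2 :=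
  match u with ThDth | Dth => 0 | DthTh | Th => 1 end.

Definition sdcoef k l u x : F := ((x (sdrow u) (sdcol u))@_k)`_l.

Lemma sdcoef_is_linear k l u : linear_for *%R (sdcoef k l u).
Proof.
move=> c x y; rewrite /sdcoef sd_addE sd_scaleE mcoeffD coefD; congr (_ + _).
by rewrite {1}/GRing.scale /= /dscale mcoeffZ mul_polyC coefZ.
Qed.

HB.instance Definition _ k l u :=
  GRing.isLinear.Build F (SD F) F *%R (sdcoef k l u) (@sdcoef_is_linear k l u).

Lemma sdunit_eltE u : sdunit_elt F u = delta_mx (sdrow u) (sdcol u).
Proof.
have E i j k l : (delta_mx i j : SD F) k l = ((k == i) && (l == j))%:R.
  by rewrite mxE.
by case: u => //=; apply: sdP;
  rewrite !sd_mulE !thetaE !dthetaE E /= ?(mul1r, mulr1, mul0r, mulr0, addr0, add0r).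
Qed.

Lemma sdmonE k l u : sdmon F k l u = dmx (tD k 'X^l) * sdunit_elt F u.
Proof. by rewrite -tpow_horner rmorphXn /= horner_algX. Qed.

Lemma dmx_unitE (w : diffop F) u i j :
  (dmx w * sdunit_elt F u) i j = w *+ ((i == sdrow u) && (j == sdcol u)).
Proof.
have E k l : (delta_mx (sdrow u) (sdcol u) : SD F) k l =
    ((k == sdrow u) && (l == sdcol u))%:R by rewrite mxE.
rewrite sdunit_eltE sd_mulE !E !dmxE.
by case: (ord2P i) => ->; case: (ord2P j) => ->; case: u E => E;
  rewrite /= ?(mul1r, mulr1, mul0r, mulr0, addr0, add0r, mulr1n, mulr0n).
Qed.

Lemma sd_unit_sum x :
  x = \sum_(u <- [:: ThDth; DthTh; Th; Dth])
        dmx (x (sdrow u) (sdcol u)) * sdunit_elt F u.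
Proof.
rewrite !big_cons big_nil; apply: sdP; rewrite !sd_addE !dmx_unitE /= sd_0E
  ?(mulr1n, mulr0n, add0r, addr0) //.
Qed.

Lemma sdrow_col_inj u v : sdrow u = sdrow v -> sdcol u = sdcol v -> u = v.
Proof. by case: u; case: v. Qed.

Lemma sdcoef_sdmon_id k l u : sdcoef k l u (sdmon F k l u) = 1.
Proof.
by rewrite /sdcoef sdmonE dmx_unitE !eqxx mulr1n /tD mcoeffUU coefXn eqxx.
Qed.

Lemma sdcoef_sdmon_neq k l u k' l' u' :
  (k, l, u) <> (k', l', u') -> sdcoef k l u (sdmon F k' l' u') = 0.
Proof.
move=> neq; rewrite /sdcoef sdmonE dmx_unitE.
case: andP => [[/eqP rE /eqP cE]|_]; last by rewrite mulr0n mcoeff0 coef0.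
rewrite mulr1n /tD mcoeffU; case: eqP => [kE|_]; last by rewrite mulr0n coef0.
rewrite mulr1n coefXn; case: eqP => // lE.
by case: neq; rewrite kE lE (sdrow_col_inj rE cE).
Qed.

(* The t^k D^l u form a basis of SD: a span of a family of them is cut out by
   the vanishing of the other coordinates. *)
Lemma lin_span_sdmonP (Q : int -> sdunit -> Prop) x :
  lin_span [set y | exists k l u, Q k u /\ y = sdmon F k l u]%classic x <->
  forall k l u, ~ Q k u -> sdcoef k l u x = 0.
Proof.
split=> [Sx k l u nQ | x0].
  move: x Sx; apply: lin_span_ind; first exact: raddf0.
  move=> c x y [k' [l' [u' [Qku ->]]]] IH.
  rewrite linearP /= IH addr0 sdcoef_sdmon_neq ?mulr0 // => -[ke _ ue].
  by apply: nQ; rewrite ke ue.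
rewrite [x]sd_unit_sum; apply: lin_span_sum => u.
rewrite {1}[x _ _]diffopE (big_morph (@dmx F) (@dmxD F) (@dmx0 F)) mulr_suml.
apply: lin_span_sum => k.
rewrite -{1}[_@_k]coefK poly_def.
rewrite (big_morph (tD k) (@tDD F k) (@tD0 F k)).
rewrite (big_morph (@dmx F) (@dmxD F) (@dmx0 F)) mulr_suml.
apply: lin_span_sum => l.
rewrite -scale_tD dmxZ -scalerAl -sdmonE.
have [Qku|nQ] := boolp.pselect (Q k u).
  by apply: lin_spanZ; exists k, l, u.
by have := x0 k l u nQ; rewrite /sdcoef => ->; rewrite scale0r; apply: lin_span0.
Qed.

Lemma SDparityP p x : SDparity p x <->
  forall u, sdunit_odd u != p -> x (sdrow u) (sdcol u) = 0.
Proof.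
rewrite /SDparity (lin_span_sdmonP (fun _ u => sdunit_odd u = p)).
split=> [h u /eqP pu|h k l u /eqP/h]; last first.
  by rewrite /sdcoef => ->; rewrite mcoeff0 coef0.
apply/malgP => k; rewrite mcoeff0; apply/polyP => l; rewrite coef0.
exact: h.
Qed.

End Basis.

(* Exactly one linear map satisfies this: see sdtau_sigma for existence and
   sigma_unique for uniqueness; it is an involution (sigma_involutive). *)
Record is_sigma_mp (F : fieldType) (a : F) (sigma : {linear SD F -> SD F}) :
    Prop := IsSigmaMP {
  sigma_antimul : forall (p q : bool) (x y : SD F),
    SDparity p x -> SDparity q y ->
    sigma (x * y) = (-1) ^+ (p && q) * (sigma y * sigma x);
  sigma_t : sigma (tpow F 1) = - tpow F 1;
  sigma_D : sigma (SDD F) = - SDD F + a%:A;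
  sigma_theta : sigma (theta F) = theta F;
  sigma_dtheta : sigma (dtheta F) = - dtheta F
}.

Definition reflp (F : fieldType) (a : F) (k : int) (f : {poly F}) : {poly F} :=
  (-1 : F) ^ k *: (f \Po (- 'X + (a - k%:~R)%:P)).

HB.lock Definition tau (F : fieldType) (a : F) (x : diffop F) : diffop F :=
  \sum_(k <- msupp x) tD k (reflp a k x@_k).

Section Sigma.
Variables (F : fieldType) (a : F).
Local Notation reflp := (reflp a).
Local Notation tau := (tau a).

Lemma reflD k f g : reflp k (f + g) = reflp k f + reflp k g.
Proof. by rewrite /reflp comp_polyD scalerDr. Qed.

Lemma refl0 k : reflp k 0 = 0.
Proof. by rewrite /reflp comp_poly0 scaler0. Qed.

Lemma reflZ k c f : reflp k (c *: f) = c *: reflp k f.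
Proof. by rewrite /reflp comp_polyZ !scalerA mulrC. Qed.

Lemma tauw (d : {fset int}) x : (msupp x `<=` d)%fset ->
  tau x = \sum_(k <- d) tD k (reflp k x@_k).
Proof.
move=> le; rewrite tau.unlock; apply: big_fset_incl => // k _ /mcoeff_outdom ->.
by rewrite refl0 tD0.
Qed.

Lemma tauU k f : tau (tD k f) = tD k (reflp k f).
Proof. by rewrite (tauw msuppU_le) big_seq_fset1 /tD mcoeffUU. Qed.

Lemma tauD : {morph tau : x y / x + y}.
Proof.
move=> x y; rewrite (tauw (msuppD_le x y)).
rewrite (tauw (fsubsetUl _ (msupp y))) (tauw (fsubsetUr (msupp x) _)).
by rewrite -big_split /=; apply: eq_bigr => k _; rewrite mcoeffD reflD tDD.
Qed.

Lemma tau0 : tau 0 = 0. Proof. by rewrite -(tD0 F 0) tauU refl0. Qed.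

Lemma tauZ c x : tau (c *: x) = c *: tau x.
Proof.
elim/diffop_ind: x => [|k f x IH]; first by rewrite tau0 !scaler0 tau0.
by rewrite scalerDr !tauD IH scalerDr scale_tD !tauU scale_tD reflZ.
Qed.

Lemma tau_tDM k m f g : tau (tD k f * tD m g) = tau (tD m g) * tau (tD k f).
Proof.
rewrite tDM !tauU tDM [m + k]addrC; congr (tD _ _).
rewrite /reflp pshiftZ -scalerAl -scalerAr scalerA; congr (_ *: _).
  by rewrite expfzDr ?oppr_eq0 ?oner_eq0 // mulrC.
rewrite comp_polyM /pshift -!comp_polyA mulrC; congr (_ * _).
  congr (_ \Po _); rewrite comp_polyD comp_polyC raddfN /= comp_polyX.
  by rewrite opprD -addrA -polyCN -polyCD intrD; congr (_ + _%:P); rewrite !opprD addrCA.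
congr (_ \Po _); rewrite comp_polyD comp_polyC comp_polyX.
by rewrite -addrA -polyCD intrD opprD addrA subrK.
Qed.

Lemma tauM x y : tau (x * y) = tau y * tau x.
Proof.
elim/diffop_ind: x => [|k f x IHx]; first by rewrite !(tau0, mul0r, mulr0).
rewrite mulrDl !tauD IHx mulrDr; congr (_ + _); clear x IHx.
elim/diffop_ind: y => [|m g y IHy]; first by rewrite !(tau0, mul0r, mulr0).
by rewrite mulrDr !tauD IHy mulrDl tau_tDM.
Qed.

Lemma tauN x : tau (- x) = - tau x.
Proof. by rewrite -!scaleN1r tauZ. Qed.

Lemma tau1 : tau 1 = 1.
Proof. by rewrite [LHS]tauU /reflp expr0z scale1r -polyC1 comp_polyC. Qed.

Definition sdtau (x : SD F) : SD F :=
  \matrix_(i, j) (if i == j then tau (x (1 - i) (1 - i))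
                  else if i == 0 then tau (x i j) else - tau (x i j)).

Lemma sdtau00 x : sdtau x 0 0 = tau (x 1 1).
Proof. by rewrite mxE eqxx (_ : 1 - 0 = 1 :> 'I_2) //; apply/val_inj. Qed.
Lemma sdtau11 x : sdtau x 1 1 = tau (x 0 0).
Proof. by rewrite mxE eqxx (_ : 1 - 1 = 0 :> 'I_2) //; apply/val_inj. Qed.
Lemma sdtau01 x : sdtau x 0 1 = tau (x 0 1). Proof. by rewrite mxE. Qed.
Lemma sdtau10 x : sdtau x 1 0 = - tau (x 1 0). Proof. by rewrite mxE. Qed.

Definition sdtauE := (sdtau00, sdtau01, sdtau10, sdtau11).

Lemma sdtau_is_linear : linear sdtau.
Proof.
move=> c x y; apply: sdP; rewrite !(sdtauE, sd_addE, sd_scaleE) !tauD tauZ //.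
by rewrite scalerN opprD.
Qed.

HB.instance Definition _ :=
  GRing.isLinear.Build F (SD F) (SD F) *:%R sdtau sdtau_is_linear.

Lemma sdtau_dmx u : sdtau (dmx u) = dmx (tau u).
Proof.
by apply: sdP; rewrite !(sdtauE, dmxE) /= ?mulr1n ?mulr0n ?tau0 ?oppr0.
Qed.

Lemma sdtau_antimul (p q : bool) (x y : SD F) :
  SDparity p x -> SDparity q y ->
  sdtau (x * y) = (-1) ^+ (p && q) * (sdtau y * sdtau x).
Proof.
move=> /SDparityP hx /SDparityP hy.
have [x0 x1] : (p -> x 0 0 = 0 /\ x 1 1 = 0) /\ (~~ p -> x 0 1 = 0 /\ x 1 0 = 0).
  split=> hp; split.
  - by apply: (hx ThDth); case: p hp {hx}.
  - by apply: (hx DthTh); case: p hp {hx}.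
  - by apply: (hx Th); case: p hp {hx}.
  - by apply: (hx Dth); case: p hp {hx}.
have [y0 y1] : (q -> y 0 0 = 0 /\ y 1 1 = 0) /\ (~~ q -> y 0 1 = 0 /\ y 1 0 = 0).
  split=> hp; split.
  - by apply: (hy ThDth); case: q hp {hy}.
  - by apply: (hy DthTh); case: q hp {hy}.
  - by apply: (hy Th); case: q hp {hy}.
  - by apply: (hy Dth); case: q hp {hy}.
rewrite -signr_odd oddb.
case: p x0 x1 {hx} => [/(_ isT)[x0 x0'] _|_ /(_ isT)[x0 x0']];
case: q y0 y1 {hy} => [/(_ isT)[y0 y0'] _|_ /(_ isT)[y0 y0']];
  rewrite /= ?expr1 ?expr0 ?mulN1r ?mul1r; apply: sdP;
  rewrite !(sd_oppE, sdtauE, sd_mulE) ?x0 ?x0' ?y0 ?y0' ?tauD ?tauM ?tau0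
    ?(mulr0, mul0r, addr0, add0r, oppr0, tau0, mulrN, mulNr, opprK) //.
Qed.

Lemma sdtau_sigma : is_sigma_mp a sdtau.
Proof.
split.
- exact: sdtau_antimul.
- rewrite /= /tpow sdtau_dmx tauU /reflp expr1z -[X in X \Po _]polyC1 comp_polyC polyC1.
  by rewrite scaleN1r tDN; apply: sdP; rewrite !(sd_oppE, dmxE) mulNrn.
- rewrite /= /SDD sdtau_dmx tauU /reflp expr0z scale1r comp_polyX subr0 tDD tDN tD0C.
  rewrite dmxD dmxZ dmx1; congr (_ + _).
  by apply: sdP; rewrite !(sd_oppE, dmxE) mulNrn.
- by apply: sdP; rewrite !(sdtauE, thetaE) /= ?tau0 ?tau1 ?oppr0.
- by apply: sdP; rewrite !(sdtauE, sd_oppE, dthetaE) /= ?tau0 ?tau1 ?oppr0.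
Qed.

Lemma SDparity_dmx (u : diffop F) : SDparity false (dmx u).
Proof. by apply/SDparityP => -[] //= _; rewrite dmxE. Qed.

Lemma SDparity_unit u : SDparity (sdunit_odd u) (sdunit_elt F u).
Proof.
apply/SDparityP => v.
have -> : sdunit_elt F u = dmx 1 * sdunit_elt F u by rewrite dmx1 mul1r.
by rewrite dmx_unitE; case: u; case: v.
Qed.

Section Unique.
Variables (s : {linear SD F -> SD F}).
Hypothesis s_sigma : is_sigma_mp a s.

Lemma sigma_evenM p x y : SDparity false x -> SDparity p y ->
  s (x * y) = s y * s x.
Proof. by move=> xe ye; rewrite (sigma_antimul s_sigma xe ye) mul1r. Qed.

Lemma sigma_1 : s 1 = 1.
Proof.
have e u := SDparity_dmx u.
have := sigma_evenM (e (tD 1 1)) (e 1); rewrite -/(tpow F 1) dmx1 mulr1.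
rewrite (sigma_t s_sigma) => /(congr1 (fun z => - z * tpow F (- 1))).
by rewrite opprK mulrN opprK -mulrA -tpowD subrr tpow0 mulr1.
Qed.

Lemma sigma_tV : s (tpow F (- 1)) = - tpow F (- 1).
Proof.
have := sigma_evenM (SDparity_dmx (tD 1 1)) (SDparity_dmx (tD (- 1) 1)).
rewrite -/(tpow F 1) -/(tpow F (- 1)) -tpowD subrr tpow0 sigma_1.
rewrite (sigma_t s_sigma) mulrN => /(congr1 (fun z => z * tpow F (- 1))).
by rewrite mul1r mulNr -mulrA -tpowD subrr tpow0 mulr1 => E; rewrite [in RHS]E opprK.
Qed.

End Unique.

Lemma sigma_unique (s s' : {linear SD F -> SD F}) :
  is_sigma_mp a s -> is_sigma_mp a s' -> s =1 s'.
Proof.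
move=> hs hs'.
have evenM u (y : SD F) p : SDparity p y -> s (dmx u) = s' (dmx u) ->
    s y = s' y -> s (dmx u * y) = s' (dmx u * y).
  move=> yp eu ey.
  by rewrite (sigma_evenM hs (SDparity_dmx u) yp) (sigma_evenM hs' (SDparity_dmx u) yp) eu ey.
have linE c x y : s x = s' x -> s y = s' y -> s (c *: x + y) = s' (c *: x + y).
  by move=> ex ey; rewrite [LHS]linearP [RHS]linearP ex ey.
have et (n : nat) e : s (tpow F e) = s' (tpow F e) ->
    s (tpow F (e *+ n)) = s' (tpow F (e *+ n)).
  move=> ee; elim: n => [|n IH]; first exact: (etrans (sigma_1 hs) (esym (sigma_1 hs'))).
  by rewrite mulrS tpowD; apply: evenM (SDparity_dmx _) _ IH.
have etp k : s (tpow F k) = s' (tpow F k).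
  case: k => n; last first.
    rewrite NegzE -[n.+1%:Z]natz -mulNrn; apply: et.
    by rewrite (sigma_tV hs) (sigma_tV hs').
  by rewrite -[Posz n]natz; apply: et; rewrite (sigma_t hs) (sigma_t hs').
have eD l : s (SDD F ^+ l) = s' (SDD F ^+ l).
  elim: l => [|l IH]; first exact: (etrans (sigma_1 hs) (esym (sigma_1 hs'))).
  have IHX : dmx (tD 0 'X^l) = SDD F ^+ l.
    by rewrite -horner_SDD rmorphXn /= horner_algX.
  rewrite exprSr -IHX; apply: evenM (SDparity_dmx _) _ _; first by rewrite IHX.
  by rewrite -/(SDD F) (sigma_D hs) (sigma_D hs').
have eU u : s (sdunit_elt F u) = s' (sdunit_elt F u).
  have th := SDparity_unit Th; have dth := SDparity_unit Dth.
  case: u => /=; rewrite ?(sigma_antimul hs th dth) ?(sigma_antimul hs' th dth)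
    ?(sigma_antimul hs dth th) ?(sigma_antimul hs' dth th) /=;
  by rewrite !(sigma_theta hs, sigma_theta hs', sigma_dtheta hs, sigma_dtheta hs').
move=> x; have : lin_span
    [set y | exists k l u, True /\ y = sdmon F k l u]%classic x.
  by apply/(lin_span_sdmonP (fun _ _ => True)) => k l u [].
move: x; apply: lin_span_ind; first by rewrite !raddf0.
move=> c x y [k [l [u [_ ->]]]] IH.
apply: linE IH.
rewrite sdmonE; apply: (evenM _ _ _ (SDparity_unit u) _ (eU u)).
have -> : dmx (tD k 'X^l) = tpow F k * SDD F ^+ l.
  by rewrite -tpow_horner rmorphXn /= horner_algX.
have IHX : dmx (tD 0 'X^l) = SDD F ^+ l.
  by rewrite -horner_SDD rmorphXn /= horner_algX.
by apply: evenM (etp k) (eD l); rewrite -IHX; apply: SDparity_dmx.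
Qed.

Lemma reflK k f : reflp k (reflp k f) = f.
Proof.
rewrite /reflp comp_polyZ scalerA -expfzMl mulrNN mulr1 exp1rz scale1r.
rewrite -comp_polyA comp_polyD comp_polyC raddfN /= comp_polyX.
by rewrite opprD opprK subrK comp_polyXr.
Qed.

Lemma sigma_involutive (s : {linear SD F -> SD F}) :
  is_sigma_mp a s -> involutive s.
Proof.
move=> hs x; rewrite !(sigma_unique hs sdtau_sigma) /=.
have tauK : involutive tau.
  elim/diffop_ind => [|k f y IH]; first by rewrite !tau0.
  by rewrite !tauD IH !tauU reflK.
by apply: sdP; rewrite !sdtauE ?tauN ?tauK ?opprK.
Qed.

End Sigma.

(* SD^sigma, and its component of degree q for the principal gradation. *)
Definition sdsub (F : fieldType) (s : SD F -> SD F) : set (SD F) :=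
  [set e | s e = - e]%classic.

Definition sdsub_deg (F : fieldType) (s : SD F -> SD F) (q : rat) : set (SD F) :=
  (sdsub s `&` SDdeg q)%classic.

(* C^(0)[w] and C^(1)[w]: the even and the odd polynomials. *)
Definition parity_poly (F : fieldType) (e : bool) : set {poly F} :=
  [set f | f \Po (- 'X) = (-1) ^+ e *: f]%classic.

Definition bar (k : int) : bool := ~~ odd `|k|.

(* Main.v *)
Require Import Defs.
From mathcomp Require Import all_boot all_order all_algebra.
From mathcomp Require Import classical_sets reals.
From mathcomp.real_closed Require Import complex.
From mathcomp Require Import ring zify.
From mathcomp.multinomials Require Import monalg.

Set Implicit Arguments.
Unset Strict Implicit.
Unset Printing Implicit Defensive.

Import GRing.Theory Num.Theory.
Local Open Scope ring_scope.
Local Open Scope classical_set_scope.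

(** The elements of SD are 2 x 2 matrices over the differential operators
    t^k f(D), and in these terms the anti-involution is explicit: by uniqueness
    it is the map [sdtau], which exchanges the two diagonal entries, fixes the
    position of theta, negates at the position of d_theta, and applies to every
    entry the anti-involution of the differential operators

      t^k f(D)  |->  t^k (-1)^k f(-D + a - k),

    that is, [reflp a k] on the coefficient of t^k.

    A homogeneous element of integral degree j has entries t^j p(D) and
    t^j f(D) on the diagonal and nothing else ([SDdeg_intP]).  Since sigma
    exchanges them, sigma(e) = -e just expresses p as minus the reflection of f
    (the other equation follows because the reflection is an involution), and
    f remains arbitrary ([sdsub_diagP]).

    In degree j - 1/2 only theta t^(j-1) p(D) and d_theta t^j f(D) survive
    ([SDdeg_halfP]), and sigma acts on each separately: p and f must be
    eigenvectors of the reflection for k = j - 1 and k = j, with eigenvalues -1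
    and 1 ([sdsub_antidiagP]).  The substitution D |-> -D + a - k is the central
    symmetry about (a - k)/2.  Translating the origin to that centre turns
    it into w |-> -w, so that the eigenvectors become the even or odd
    polynomials ([reflp_centeredP]); the two signs (-1)^(j-1) * (-1) and
    (-1)^j agree, which is why the same parity governs both summands. *)

(** * Reflections of polynomials *)

Section Reflections.
Variables (F : fieldType) (a : F).
Implicit Types (f : {poly F}) (k j : int).

Lemma reflpN k f : reflp a k (- f) = - reflp a k f.
Proof. by rewrite -!scaleN1r reflZ. Qed.

Lemma comp_polyXDK f (c : F) : (f \Po ('X + c%:P)) \Po ('X - c%:P) = f.
Proof.
by rewrite -comp_polyA comp_polyD comp_polyX comp_polyC subrK comp_polyXr.
Qed.

Lemma comp_polyXBK f (c : F) : (f \Po ('X - c%:P)) \Po ('X + c%:P) = f.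
Proof. by have := comp_polyXDK f (- c); rewrite polyCN opprK. Qed.

(** With c = (k - a)/2, the translation by c conjugates the reflection attached
    to t^k to the central symmetry w |-> -w.  Applied with e = 1 or
    e = -1, this makes the eigenvectors of the reflection the translates of the
    even and odd polynomials. *)
Lemma reflp_centeredP k (c e : F) f : c + c = k%:~R - a ->
  reflp a k (f \Po ('X + c%:P)) = e *: (f \Po ('X + c%:P)) <->
  f \Po (- 'X) = ((-1) ^ k * e) *: f.
Proof.
move=> cE.
have -> : reflp a k (f \Po ('X + c%:P))
        = (-1) ^ k *: ((f \Po (- 'X)) \Po ('X + c%:P)).
  rewrite /reflp -!comp_polyA; congr (_ *: (_ \Po _)).
  rewrite comp_polyD comp_polyX comp_polyC raddfN /= comp_polyX.
  by rewrite -opprB -cE opprD -addrA -polyCD addrNK polyCN opprD.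
have sK (g : {poly F}) : (-1) ^ k *: ((-1) ^ k *: g) = g.
  by rewrite scalerA -expfzMl mulrNN mulr1 exp1rz scale1r.
split=> [/(congr1 (fun g => (-1) ^ k *: (g \Po ('X - c%:P))))|->].
  by rewrite !comp_polyZ !comp_polyXDK sK scalerA.
by rewrite comp_polyZ -scalerA sK.
Qed.

Lemma sign_bar j : (-1) ^+ bar (j + 1) = (-1) ^ j :> F.
Proof.
have -> : bar (j + 1) = odd `|j| by rewrite /bar; lia.
by rewrite signr_odd; case: j => n //=; rewrite -invr_sign.
Qed.

Lemma sign_predN1 j : (-1) ^ (j - 1) * -1 = (-1) ^ j :> F.
Proof. by rewrite -{2}(expr1z (-1)) -expfzDr ?subrK ?oppr_eq0 ?oner_eq0. Qed.

End Reflections.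

(** * Homogeneous elements *)

Section Homogeneous.
Variable F : fieldType.
Implicit Types (x : SD F) (f g p : {poly F}) (k : int) (q : rat) (u : sdunit).

Definition sdterm k f u : SD F := dmx (tD k f) * sdunit_elt F u.

Lemma tD_inj k : injective (@tD F k).
Proof.
by move=> f g /(congr1 (fun x : diffop F => x@_k)); rewrite /tD !mcoeffUU.
Qed.

Lemma sdtermE k f u i l :
  sdterm k f u i l = tD k f *+ ((i == sdrow u) && (l == sdcol u)).
Proof. exact: dmx_unitE. Qed.

Lemma sdtermN k f u : sdterm k (- f) u = - sdterm k f u.
Proof.
by rewrite /sdterm tDN -mulNr; congr (_ * _); apply: sdP;
  rewrite !(sd_oppE, dmxE) mulNrn.
Qed.

Lemma SDdeg_entryP q x :
  SDdeg q x <->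
  forall u k, sdmon_wt k u <> q -> (x (sdrow u) (sdcol u))@_k = 0.
Proof.
rewrite /SDdeg (lin_span_sdmonP (fun k u => sdmon_wt k u = q)).
split=> [x0 u k nq | x0 k l u nq]; last by rewrite /sdcoef x0 // coef0.
by apply/polyP => l; rewrite coef0; apply: x0.
Qed.

(** For a fixed u the weight of t^k D^l u determines k, so that an entry of a
    homogeneous element is concentrated in a single power of t. *)
Lemma SDdeg_entry q x k u : SDdeg q x -> sdmon_wt k u = q ->
  x (sdrow u) (sdcol u) = tD k (x (sdrow u) (sdcol u))@_k.
Proof.
move=> /SDdeg_entryP xq kq; apply/malgP => m; rewrite /tD mcoeffU.
have [->|/eqP nkm] := eqVneq k m; first by rewrite mulr1n.
rewrite mulr0n; apply: xq => mq; apply: nkm; apply/eqP.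
by rewrite -(eqr_int rat) -(can_eq (addrK (sdunit_wt u))) -!/(sdmon_wt _ _) kq mq.
Qed.

Lemma SDdeg_entry0 q x u : SDdeg q x -> (forall k, sdmon_wt k u <> q) ->
  x (sdrow u) (sdcol u) = 0.
Proof.
by move=> /SDdeg_entryP xq nq; apply/malgP => k; rewrite mcoeff0 xq.
Qed.

Lemma SDdeg_sdterm k f u : SDdeg (sdmon_wt k u) (sdterm k f u).
Proof.
apply/SDdeg_entryP => v m nq; rewrite sdtermE.
case: andP => [[/eqP er /eqP ec]|_]; last by rewrite mulr0n mcoeff0.
rewrite mulr1n /tD mcoeffU; case: eqP => [km|_]; last by rewrite mulr0n.
by case: nq; rewrite km (sdrow_col_inj er ec).
Qed.

Lemma int_neq_half (n : int) : n%:~R <> 2%:R^-1 :> rat.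
Proof.
move=> /(congr1 (fun z : rat => z * 2%:R)).
rewrite mulVf ?pnatr_eq0 // -[2%:R]/(2%:~R) -intrM -[1]/(1%:~R) => /eqP.
by rewrite eqr_int => /eqP; lia.
Qed.

(** The weights of theta and d_theta are half-integers, which excludes these
    units from integral degrees, just as the other two are excluded below. *)
Lemma SDdeg_intP (j : int) x :
  SDdeg j%:~R x <-> exists p f, x = sdterm j p ThDth + sdterm j f DthTh.
Proof.
split=> [xj|[p [f ->]]]; last first.
  by apply: lin_spanD; have := @SDdeg_sdterm j; rewrite /sdmon_wt => h;
    [have := h p ThDth | have := h f DthTh]; rewrite addr0.
exists (x 0 0)@_j, (x 1 1)@_j; apply: sdP; rewrite sd_addE !sdtermE /=.
- by rewrite addr0; apply: (@SDdeg_entry _ _ _ ThDth xj); rewrite /sdmon_wt addr0.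
- rewrite addr0; apply: (@SDdeg_entry0 _ _ Th xj) => k.
  by rewrite /sdmon_wt => kj; apply: (@int_neq_half (j - k)); rewrite intrB -kj addrC addKr.
- rewrite addr0; apply: (@SDdeg_entry0 _ _ Dth xj) => k.
  by rewrite /sdmon_wt => kj; apply: (@int_neq_half (k - j)); rewrite intrB -kj opprD opprK addNKr.
- by rewrite add0r; apply: (@SDdeg_entry _ _ _ DthTh xj); rewrite /sdmon_wt addr0.
Qed.

Lemma SDdeg_halfP (j : int) x :
  SDdeg (j%:~R - 2%:R^-1) x <->
  exists p f, x = sdterm (j - 1) p Th + sdterm j f Dth.
Proof.
have wth : sdmon_wt (j - 1) Th = j%:~R - 2%:R^-1.
  by rewrite /sdmon_wt /= intrB; field.
split=> [xj|[p [f ->]]]; last first.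
  by apply: lin_spanD; [rewrite -wth | rewrite -[_ - _]/(sdmon_wt j Dth)];
    apply: SDdeg_sdterm.
have nint k : k%:~R <> j%:~R - 2%:R^-1 :> rat.
  move=> kj; apply: (@int_neq_half (j - k)).
  by rewrite intrB kj opprB addrC subrK.
exists (x 0 1)@_(j - 1), (x 1 0)@_j; apply: sdP; rewrite sd_addE !sdtermE /=.
- rewrite addr0; apply: (@SDdeg_entry0 _ _ ThDth xj) => k.
  by rewrite /sdmon_wt addr0; apply: nint.
- by rewrite addr0; apply: (@SDdeg_entry _ _ _ Th xj).
- by rewrite add0r; apply: (@SDdeg_entry _ _ _ Dth xj).
- rewrite addr0; apply: (@SDdeg_entry0 _ _ DthTh xj) => k.
  by rewrite /sdmon_wt addr0; apply: nint.
Qed.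

End Homogeneous.

(** * The condition sigma(e) = -e on homogeneous elements *)

Section FixedPoints.
Variables (F : fieldType) (a : F) (sigma : {linear SD F -> SD F}).
Hypothesis Hsigma : is_sigma_mp a sigma.
Implicit Types (f g p : {poly F}) (k j : int).

(** The (1, 1) entry of sigma(e) = -e gives f = - reflp a j p, which is
    equivalent to the stated condition because [reflp a j] is an involution. *)
Lemma sdsub_diagP j p f :
  sdsub sigma (sdterm j p ThDth + sdterm j f DthTh) <-> p = - reflp a j f.
Proof.
rewrite /sdsub /= (sigma_unique Hsigma (sdtau_sigma a)).
split=> [/(congr1 (fun x : SD F => x 0 0))|->].
  rewrite /= sdtau00 sd_oppE !sd_addE !sdtermE /= !(add0r, addr0) tauU -tDN.
  by move=> /tD_inj ->; rewrite opprK.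
apply: sdP; rewrite /= ?sdtauE !(sd_oppE, sd_addE) !sdtermE /=
  !(mulr1n, add0r, addr0) ?tauU ?tau0 ?oppr0 -?tDN ?opprK //.
by rewrite reflpN reflK.
Qed.

(** The asymmetry between the two conditions comes from
    sigma(theta) = theta and sigma(d_theta) = - d_theta. *)
Lemma sdsub_antidiagP k m p f :
  sdsub sigma (sdterm k p Th + sdterm m f Dth) <->
  reflp a k p = - p /\ reflp a m f = f.
Proof.
rewrite /sdsub /= (sigma_unique Hsigma (sdtau_sigma a)).
split=> [E|[Ep Ef]].
  have := congr1 (fun x : SD F => x 0 1) E.
  rewrite /= sdtau01 sd_oppE !sd_addE !sdtermE /= !addr0 tauU -tDN => /tD_inj ->.
  have := congr1 (fun x : SD F => x 1 0) E.
  rewrite /= sdtau10 sd_oppE !sd_addE !sdtermE /= !add0r tauU.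
  by move=> /oppr_inj /tD_inj ->.
apply: sdP; rewrite /= ?sdtauE !(sd_oppE, sd_addE) !sdtermE /=
  !(mulr1n, add0r, addr0) ?tauU ?tau0 ?oppr0 ?Ep ?Ef -?tDN //.
Qed.

End FixedPoints.

(** * The families of the theorem as homogeneous terms *)

Section Forms.
Variable F : fieldType.
Implicit Types (f : {poly F}) (k j : int) (c : F).

Lemma theta_horner k c f :
  theta F * tpow F k * horner_alg (SDD F + c%:A) f =
  sdterm k (f \Po ('X + c%:P)) Th.
Proof.
rewrite horner_SDDc theta_dmx -mulrA theta_dmx mulrA -dmxM tDM.
by rewrite addr0 pshift0 mul1r.
Qed.

Lemma dtheta_horner k c f :
  dtheta F * tpow F k * horner_alg (SDD F + c%:A) f =
  sdterm k (f \Po ('X + c%:P)) Dth.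
Proof.
rewrite horner_SDDc dtheta_dmx -mulrA dtheta_dmx mulrA -dmxM tDM.
by rewrite addr0 pshift0 mul1r.
Qed.

Lemma dtheta_theta_horner j f :
  dtheta F * theta F * tpow F j * horner_alg (SDD F) f = sdterm j f DthTh.
Proof.
rewrite -mulrA tpow_horner /sdterm /= -mulrA theta_dmx mulrA dtheta_dmx mulrA.
by [].
Qed.

(** The right-hand side is the image under sigma of d_theta theta t^j f(D), so
    that the family in degree j consists of the differences b - sigma(b). *)
Lemma theta_dtheta_horner (a : F) j f :
  (-1) ^ j *: (theta F * dtheta F * tpow F j *
    horner_alg (- SDD F - j%:~R + a%:A) f) = sdterm j (reflp a j f) ThDth.
Proof.
have -> : - SDD F - j%:~R + a%:A = dmx (tD 0 (- 'X + (a - j%:~R)%:P)).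
  rewrite tDD tDN tD0C dmxD dmxZ dmx1 -addrA; congr (_ + _).
    by apply: sdP; rewrite !(sd_oppE, dmxE) mulNrn.
  by rewrite scalerBl addrC scaler_int.
rewrite horner_dmx -mulrA -dmxM tDM pshift0 mul1r addr0 -mulrA dtheta_dmx mulrA.
by rewrite theta_dmx scalerAl scalerAl -dmxZ scale_tD -mulrA.
Qed.

End Forms.

Theorem proposition4p4 (R : realType) (a : R[i]) (j : int)
    (sigma : {linear SD R[i] -> SD R[i]})
    (Hsigma : is_sigma_mp a sigma) :
  let t k := tpow R[i] k in
  let D := SDD R[i] in
  let th := theta R[i] in
  let dth := dtheta R[i] in
  sdsub_deg sigma (j%:~R : rat) =
    [set e | exists f : {poly R[i]},
       e = dth * th * t j * horner_alg D f
           - (-1) ^ j *: (th * dth * t j * horner_alg (- D - j%:~R + a%:A) f)]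
  /\
  sdsub_deg sigma (j%:~R - 2%:R^-1 : rat) =
    [set e | exists f g : {poly R[i]},
       [/\ parity_poly (bar (j + 1)) f,
           parity_poly (bar (j + 1)) g &
           e = th * t (j - 1) * horner_alg (D + ((j%:~R - a - 1) / 2%:R)%:A) f
               + dth * t j * horner_alg (D + ((j%:~R - a) / 2%:R)%:A) g]].
Proof.
move=> t D th dth; rewrite {}/t {}/D {}/th {}/dth.
set c1 := (j%:~R - a - 1) / 2%:R; set c2 := (j%:~R - a) / 2%:R.
have half (z : R[i]) : z / 2%:R + z / 2%:R = z by field.
have c1E : c1 + c1 = (j - 1)%:~R - a by rewrite half intrB addrAC.
have c2E : c2 + c2 = j%:~R - a by rewrite half.
split; apply/seteqP; split=> e /=.
- move=> [es /SDdeg_intP[p [f eE]]]; exists f.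
  move: es; rewrite eE => /(sdsub_diagP Hsigma) ->.
  by rewrite dtheta_theta_horner theta_dtheta_horner addrC sdtermN.
- move=> [f]; rewrite dtheta_theta_horner theta_dtheta_horner => eE.
  have {}eE : e = sdterm j (- reflp a j f) ThDth + sdterm j f DthTh.
    by rewrite eE addrC sdtermN.
  by rewrite eE; split; [apply/(sdsub_diagP Hsigma)|apply/SDdeg_intP; do 2?eexists].
- move=> [es /SDdeg_halfP[p [f eE]]].
  exists (p \Po ('X - c1%:P)), (f \Po ('X - c2%:P)).
  move: es; rewrite eE => /(sdsub_antidiagP Hsigma)[Ep Ef].
  rewrite /parity_poly /= sign_bar theta_horner dtheta_horner !comp_polyXBK.
  split=> //.
    have := reflp_centeredP (-1) (p \Po ('X - c1%:P)) c1E.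
    rewrite comp_polyXBK scaleN1r sign_predN1.
    by move=> h; apply/h.
  have := reflp_centeredP 1 (f \Po ('X - c2%:P)) c2E.
  by rewrite comp_polyXBK scale1r mulr1 => h; apply/h.
- move=> [f [g []]]; rewrite /parity_poly /= sign_bar => fp gp.
  rewrite theta_horner dtheta_horner => ->; split; last first.
    by apply/SDdeg_halfP; do 2?eexists.
  apply/(sdsub_antidiagP Hsigma); split.
    rewrite -scaleN1r; apply/(reflp_centeredP _ _ c1E).
    by rewrite sign_predN1.
  rewrite -[RHS]scale1r; apply/(reflp_centeredP _ _ c2E).
  by rewrite mulr1.
Qed.
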